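(* Let $m,n,c,d$ be positive integers with $n\le c\le m$, let $A\in\mathbb{R}^{m\times n}$ with $\operatorname{rank}(A)=n$, $B\in\mathbb{R}^{m\times d}$, and $S\in\mathbb{R}^{c\times m}$. Let $A=QR$ be a thin QR decomposition, where $Q\in\mathbb{R}^{m\times n}$ has orthonormal columns and $R\in\mathbb{R}^{n\times n}$ is nonsingular, and let $Q_\perp\in\mathbb{R}^{m\times(m-n)}$ be such that $(Q\;\;Q_\perp)$ is an orthogonal matrix. Put $\hat X=A^\dagger B$, $\hat R=B-A\hat X$, and $\tilde X=(SA)^\dagger SB$. If $\operatorname{rank}(SA)=\operatorname{rank}(A)$, then for every $1\le p\le\infty$, $$\|\tilde X-\hat X\|_{(p)}\le \|A^\dagger\|_2\,\|(SQ)^\dagger SQ_\perp\|_2\,\|\hat R\|_{(p)}.$$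
   Context: $M^\dagger$ denotes the Moore–Penrose inverse of $M$, and $\|M\|_2=\sigma_1(M)$ is the spectral (operator) norm. For a real matrix $M$ with singular values $\sigma_1(M)\ge\sigma_2(M)\ge\cdots\ge 0$, the Schatten $p$-norm is $\|M\|_{(p)}=\left(\sum_j\sigma_j(M)^p\right)^{1/p}$ for $1\le p<\infty$, and $\|M\|_{(\infty)}=\sigma_1(M)$. The matrix $\hat X$ is the minimal-norm solution of the exact problem $\min_{X\in\mathbb{R}^{n\times d}}\|AX-B\|_{(p)}$, with residual $\hat R$. The matrix $\tilde X$ is the minimal-norm solution of the perturbed (sketched) problem $\min_{X\in\mathbb{R}^{n\times d}}\|S(AX-B)\|_{(p)}$. *)

(* Defs.v *)
From HB Require Import structures.
From mathcomp Require Import all_boot all_order all_algebra.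
From mathcomp Require Import polyrcf complex.
From mathcomp Require Import all_classical all_reals all_analysis.

Set Implicit Arguments.
Unset Strict Implicit.
Unset Printing Implicit Defensive.
Import Order.TTheory GRing.Theory Num.Theory.
Local Open Scope classical_set_scope.
Local Open Scope ring_scope.

(* The four Penrose equations; they determine G uniquely. *)
Definition moore_penrose (K : realType) (m n : nat)
    (M : 'M[K]_(m, n)) (G : 'M[K]_(n, m)) : Prop :=
  [/\ M *m G *m M = M, G *m M *m G = G,
      (M *m G)^T = M *m G & (G *m M)^T = G *m M].

(* Existence and uniqueness are proved in mpinvP and mpinv_unique, so the
   default value 0 is never used. *)
Definition mpinv (K : realType) (m n : nat) (M : 'M[K]_(m, n)) : 'M[K]_(n, m) :=
  xget 0 [set G | moore_penrose M G].

(* Square roots of the eigenvalues of M^T M, repeated according to their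
   multiplicity in the characteristic polynomial, in decreasing order.  There
   are n of them (singular_values_char_poly), so when m < n the list ends with
   n - m zeros, which do not contribute to the Schatten norms. *)
Definition singular_values (K : realType) (m n : nat) (M : 'M[K]_(m, n)) :
    seq K :=
  let chi := char_poly (M^T *m M) in
  sort >=%R (flatten [seq nseq (mup x chi) (Num.sqrt x) | x <- rootsR chi]).

(* sigma_1 (M); it is 0 when M has no columns. *)
Definition spectral_norm (K : realType) (m n : nat) (M : 'M[K]_(m, n)) : K :=
  nth 0 (singular_values M) 0.

(* Only meant for 1 <= p <= +oo; the value at -oo is a dummy. *)
Definition schatten_norm (K : realType) (p : \bar K) (m n : nat)
    (M : 'M[K]_(m, n)) : K :=
  match p with
  | EFin q => (\sum_(s <- singular_values M) s `^ q) `^ q^-1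
  | +oo%E => nth 0 (singular_values M) 0
  | -oo%E => 0
  end.

Definition upper_triangular (K : realType) (n : nat) (M : 'M[K]_n) : Prop :=
  forall i j : 'I_n, (j < i)%N -> M i j = 0.

Definition orthonormal_columns (K : realType) (m n : nat)
    (M : 'M[K]_(m, n)) : Prop :=
  M^T *m M = 1%:M.

(* Stated for a matrix of type 'M_(m, k), because the width n + (m - n) of
   (Q  Q_perp) is equal but not convertible to m; the two equations together
   force m = k. *)
Definition orthogonal_matrix (K : realType) (m k : nat)
    (U : 'M[K]_(m, k)) : Prop :=
  U^T *m U = 1%:M /\ U *m U^T = 1%:M.

Lemma mulmx_tr_eq0 (K : realType) (m n : nat) (M : 'M[K]_(m, n)) :
  M *m M^T = 0 -> M = 0.
Proof.
move=> MM0; apply/matrixP => i j; rewrite mxE.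
have /matrixP/(_ i i) := MM0; rewrite !mxE => /eqP.
under eq_bigr => k _ do rewrite mxE -expr2.
rewrite psumr_eq0 => [/allP/(_ j)|k _]; last exact: sqr_ge0.
by rewrite mem_index_enum => /(_ isT); rewrite sqrf_eq0 => /eqP.
Qed.

Lemma gram_unitmx (K : realType) (r n : nat) (F : 'M[K]_(r, n)) :
  row_free F -> F *m F^T \in unitmx.
Proof.
move=> Ffree; rewrite -row_free_unit -kermx_eq0; apply/eqP.
set N := kermx _; have N0 : N *m (F *m F^T) = 0 by exact: mulmx_ker.
have NF0 : N *m F = 0.
  apply: mulmx_tr_eq0.
  by rewrite trmx_mul mulmxA -(mulmxA N) N0 mul0mx.
by apply: (row_free_inj Ffree); rewrite NF0 mul0mx.
Qed.

Lemma mpinv_unique (K : realType) (m n : nat) (M : 'M[K]_(m, n))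
    (G H : 'M[K]_(n, m)) :
  moore_penrose M G -> moore_penrose M H -> G = H.
Proof.
move=> [g1 g2 g3 g4] [h1 h2 h3 h4].
have MGH : M *m G = M *m H.
  rewrite -g3 -{1}h1 -(mulmxA (M *m H)) trmx_mul g3 h3.
  by rewrite mulmxA g1.
have GHM : G *m M = H *m M.
  rewrite -g4 -{1}h1 -(mulmxA M) mulmxA trmx_mul g4 h4.
  by rewrite -mulmxA (mulmxA M) g1.
by rewrite -g2 -mulmxA MGH mulmxA GHM h2.
Qed.

Lemma moore_penrose_mul (K : realType) (m r n : nat) (E : 'M[K]_(m, r))
    (F : 'M[K]_(r, n)) :
  E^T *m E \in unitmx -> F *m F^T \in unitmx ->
  moore_penrose (E *m F)
    (F^T *m invmx (F *m F^T) *m invmx (E^T *m E) *m E^T).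
Proof.
move=> Eu Fu; set iF := invmx (F *m _); set iE := invmx (_ *m E).
have iFT : iF^T = iF by rewrite /iF trmx_inv trmx_mul trmxK.
have iET : iE^T = iE by rewrite /iE trmx_inv trmx_mul trmxK.
have FK : F *m (F^T *m iF) = 1%:M by rewrite mulmxA mulmxV.
have EK : iE *m (E^T *m E) = 1%:M by rewrite mulVmx.
set G := _ *m E^T.
have MG : E *m F *m G = E *m iE *m E^T.
  by rewrite /G -!(mulmxA E) 2!(mulmxA F) FK mul1mx.
have GM : G *m (E *m F) = F^T *m iF *m F.
  by rewrite /G mulmxA -(mulmxA _ E^T) -(mulmxA _ iE) EK mulmx1.
split.
- by rewrite MG mulmxA -(mulmxA _ E^T) -(mulmxA E) EK mulmx1.
- by rewrite GM /G !mulmxA -(mulmxA _ F^T iF) -(mulmxA _ F) FK mulmx1.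
- by rewrite MG !trmx_mul trmxK iET mulmxA.
- by rewrite GM !trmx_mul trmxK iFT mulmxA.
Qed.

Lemma mpinvP (K : realType) (m n : nat) (M : 'M[K]_(m, n)) :
  moore_penrose M (mpinv M).
Proof.
rewrite /mpinv; case: xgetP => [G _ //|noG].
have Fu : row_base M *m (row_base M)^T \in unitmx.
  by apply: gram_unitmx; exact: row_base_free.
have Eu : (col_base M)^T *m col_base M \in unitmx.
  rewrite -[X in _ *m X]trmxK; apply: gram_unitmx.
  by rewrite /row_free mxrank_tr; exact: col_base_full.
by have := moore_penrose_mul Eu Fu; rewrite mulmx_base => /noG.
Qed.

Local Open Scope complex_scope.

Lemma eigenvalue_gram_ge0 (K : realType) (m n : nat) (M : 'M[K]_(m, n))
    (r : K[i]) :
  root (char_poly (map_mx (real_complex K) (M^T *m M))) r -> 0 <= r.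
Proof.
rewrite -eigenvalue_root_char => /eigenvalueP[v vr v_neq0].
pose N := map_mx (real_complex K) M; pose w := v *m N^T.
have NJ : map_mx conjc N = N by apply/matrixP => i j; rewrite !mxE conjc_real.
have NN : map_mx (real_complex K) (M^T *m M) = N^T *m N.
  by rewrite map_mxM -map_trmx.
have sqw : (w *m map_mx conjc w^T) 0 0 = r * (v *m map_mx conjc v^T) 0 0.
  transitivity ((r *: (v *m map_mx conjc v^T)) 0 0); last by rewrite [LHS]mxE.
  by rewrite scalemxAl -vr NN /w trmx_mul trmxK map_mxM NJ !mulmxA.
have sq_ge0 k (u : 'rV[K[i]]_k) : 0 <= (u *m map_mx conjc u^T) 0 0.
  by rewrite mxE sumr_ge0 // => j _; rewrite !mxE mulcJ_ge0.
have vv_gt0 : 0 < (v *m map_mx conjc v^T) 0 0.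
  rewrite lt_neqAle sq_ge0 andbT eq_sym; apply: contraNneq v_neq0 => /eqP.
  rewrite mxE psumr_eq0 => [/allP v0|j _]; last by rewrite !mxE mulcJ_ge0.
  apply/eqP/rowP => j; have := v0 j; rewrite mem_index_enum => /(_ isT).
  by rewrite !mxE mulf_eq0 conjc_eq0 orbb => /eqP.
by rewrite -(pmulr_lge0 _ vv_gt0) -sqw sq_ge0.
Qed.

Lemma singular_values_char_poly (K : realType) (m n : nat)
    (M : 'M[K]_(m, n)) :
  char_poly (M^T *m M) =
    \prod_(s <- singular_values M) ('X - (s ^+ 2)%:P) /\
  size (singular_values M) = n.
Proof.
set chi := char_poly _.
have chi_monic : chi \is monic by exact: char_poly_monic.
have [rs rsP] := closed_field_poly_normal (map_poly (real_complex K) chi).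
have rs_ge0 r : r \in rs -> 0 <= r.
  move=> r_rs; apply: (@eigenvalue_gram_ge0 _ _ _ M).
  rewrite -map_char_poly -/chi rsP rootZ ?root_prod_XsubC //.
  by rewrite lead_coef_eq0 map_poly_eq0 monic_neq0.
pose ts := [seq complex.Re r | r <- rs].
have rsE : rs = [seq (t%:C : K[i]) | t <- ts].
  rewrite -map_comp -[LHS]map_id; apply/eq_in_map => r /rs_ge0 r_ge0 /=.
  by rewrite RRe_real // ger0_real.
have ts_ge0 t : t \in ts -> 0 <= t.
  by move=> tts; rewrite -ler0c; apply: rs_ge0; rewrite rsE map_f.
have chiE : chi = \prod_(t <- ts) ('X - t%:P).
  apply: (@map_poly_inj _ _ (real_complex K)).
  rewrite [LHS]rsP (monicP _) ?map_monic // scale1r rsE big_map rmorph_prod.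
  by apply: eq_bigr => t _; rewrite rmorphB /= map_polyX map_polyC.
have mupE x : mup x chi = count_mem x ts.
  rewrite chiE; elim: (ts) => [|t s IH]; first by rewrite big_nil mupNroot ?root1.
  rewrite big_cons mupM ?monic_neq0 ?monicXsubC ?monic_prod_XsubC //= IH.
  by rewrite -['X - _]expr1 mup_XsubCX; case: eqP.
pose es := flatten [seq nseq (mup x chi) x | x <- rootsR chi].
have svE : perm_eq (singular_values M) [seq Num.sqrt t | t <- es].
  rewrite perm_sort map_flatten -map_comp.
  by rewrite (eq_map (fun x => map_nseq (mup x chi) Num.sqrt x)).
have es_ts : perm_eq es ts.
  apply/allP => x _ /=; apply/eqP; rewrite -mupE count_flatten -map_comp.
  have cE y : (count_mem x \o (fun y => nseq (mup y chi) y)) y =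
      ((y == x) * mup x chi)%N.
    by rewrite /= count_nseq /=; case: eqP => [->|].
  rewrite (eq_map cE) sumnE big_map -big_distrl /=.
  have -> : \sum_(y <- rootsR chi) (y == x : nat) = count_mem x (rootsR chi).
    by rewrite -sum1_count [RHS]big_mkcond; apply: eq_bigr => y _ /=; case: (y == x).
  rewrite (count_uniq_mem _ (uniq_roots _ _ _)) -roots_on_rootsR ?monic_neq0 //=.
  by case: rootP => [_|/rootP/mupNroot ->]; rewrite ?mul1n ?muln0.
have sv_ts : perm_eq (singular_values M) [seq Num.sqrt t | t <- ts].
  by rewrite (perm_trans svE) // perm_map.
split.
  rewrite (perm_big _ sv_ts) big_map chiE; apply: eq_big_seq => t /ts_ge0 ?.
  by rewrite sqr_sqrtr.
rewrite (perm_size sv_ts) size_map.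
have := size_char_poly (M^T *m M).
by rewrite -/chi chiE size_prod_XsubC => -[].
Qed.

(* Main.v *)
(* Since (SA)^+ SA = 1, (SA)^+ = R^-1 (SQ)^+ and Rhat = Qperp Qperp^T B, one has
     Xtilde - Xhat = (SA)^+ S Rhat = A^+ Q W Qperp^T B,
   where A^+ = R^-1 Q^T and W = (SQ)^+ S Qperp.  As Q and Qperp are isometries,
   |(Xtilde - Xhat) v| <= |A^+| |W| |Rhat v| for every vector v, and by the
   Courant-Fischer argument such a domination passes to each singular value,
   hence to every Schatten norm.  The spectral theorem is applied over K[i], so
   the vectors v have complex entries; they are rows, and M acts by v |-> v M^T. *)
Require Import Defs.
From HB Require Import structures.
From mathcomp Require Import all_boot all_order all_fingroup all_algebra.
From mathcomp Require Import complex.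
From mathcomp Require Import all_classical all_reals all_analysis.
Set Implicit Arguments.
Unset Strict Implicit.
Unset Printing Implicit Defensive.
Import Order.TTheory GRing.Theory Num.Theory.
Local Open Scope ring_scope.
Local Open Scope sesquilinear_scope.

(** * Squared norms of complex row vectors *)

Local Notation complexify M := (map_mx (real_complex _) M).
Local Notation sqnorm v := (dotmx v v).

Lemma sqnormE (C : numClosedFieldType) (n : nat) (v : 'rV[C]_n) :
  sqnorm v = \sum_j `|v 0 j| ^+ 2.
Proof. by rewrite dotmxE mxE; apply: eq_bigr => j _; rewrite !mxE normCK. Qed.

Lemma sqnorm_mulmx (C : numClosedFieldType) (m n : nat) (v : 'rV[C]_m)
    (M : 'M[C]_(m, n)) :
  sqnorm (v *m M) = (v *m (M *m M^t*) *m v^t*) 0 0.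
Proof. by rewrite dotmxE trmx_mul map_mxM /= !mulmxA. Qed.

Lemma sqnorm_unitary (C : numClosedFieldType) (m n : nat) (v : 'rV[C]_m)
    (M : 'M[C]_(m, n)) : M \is unitarymx -> sqnorm (v *m M) = sqnorm v.
Proof. by move=> /unitarymxP MM; rewrite sqnorm_mulmx MM mulmx1 dotmxE. Qed.

Lemma adjoint_complexify (K : realType) (m n : nat) (M : 'M[K]_(m, n)) :
  (complexify M)^t* = complexify M^T.
Proof. by apply/matrixP => i j; rewrite !mxE; exact: conjc_real. Qed.

(** * Singular values and the diagonalization of the Gram matrix *)

Lemma char_poly_conjugate (F : fieldType) (n : nat) (P A : 'M[F]_n) :
  P \in unitmx -> char_poly (invmx P *m A *m P) = char_poly A.
Proof.
move=> Pu; pose P' := map_mx polyC P; pose Q := map_mx polyC (invmx P).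
have QP : Q *m P' = 1%:M by rewrite -map_mxM mulVmx // map_mx1.
have PAP : char_poly_mx (invmx P *m A *m P) = Q *m char_poly_mx A *m P'.
  rewrite /char_poly_mx !map_mxM mulmxBr mulmxBl -/Q -/P'.
  by rewrite scalar_mxC -(mulmxA 'X%:M) QP mulmx1.
by rewrite /char_poly PAP !det_mulmx mulrAC -det_mulmx QP det1 mul1r.
Qed.

Lemma singular_values_sorted (K : realType) (m n : nat) (M : 'M[K]_(m, n))
    (i j : nat) : (i <= j < n)%N ->
  nth 0 (singular_values M) j <= nth 0 (singular_values M) i.
Proof.
move=> /andP[ij jn].
have [_ sz] := singular_values_char_poly M.
have ge_tr : transitive (>=%R : rel K) by move=> x y z yx /le_trans; exact.
have sv_sorted : sorted >=%R (singular_values M).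
  by rewrite sort_sorted // => x y; exact: le_total.
apply: (sorted_leq_nth ge_tr (@lexx _ K) 0 sv_sorted) => //.
  by rewrite inE sz (leq_ltn_trans ij).
by rewrite inE sz.
Qed.

Lemma singular_value_ge0 (K : realType) (m n : nat) (M : 'M[K]_(m, n))
    (s : K) : s \in singular_values M -> 0 <= s.
Proof.
rewrite mem_sort => /flatten_mapP[x _ /nseqP[-> _]]; exact: sqrtr_ge0.
Qed.

Lemma nth_singular_value_ge0 (K : realType) (m n : nat) (M : 'M[K]_(m, n))
    (i : nat) : 0 <= nth 0 (singular_values M) i.
Proof.
have [isz|isz] := ltnP i (size (singular_values M)).
  exact/singular_value_ge0/mem_nth.
by rewrite nth_default.
Qed.

(** The spectral theorem yields the eigenvalues in unknown order. Unique factorization of the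
    characteristic polynomial makes them a permutation of the squared singular values, and permuting
    the eigenvectors sorts them. *)
Lemma gram_diagonalization (K : realType) (m n : nat) (M : 'M[K]_(m, n)) :
  exists2 P : 'M[K[i]]_n, P \is unitarymx &
    forall v : 'rV_n, sqnorm (v *m complexify M^T) =
      \sum_(j < n) ((nth 0 (singular_values M) j) ^+ 2)%:C%C
        * `|(v *m P^t*) 0 j| ^+ 2.
Proof.
have [chiE sz] := singular_values_char_poly M.
pose H := complexify (M^T *m M).
have Hn : H \is normalmx.
  by apply/normalmxP; rewrite adjoint_complexify trmx_mul trmxK.
have /orthomx_spectralP := Hn.
set Q := spectralmx H; set a := spectral_diag H => HE.
have Qu : Q \is unitarymx by exact: spectral_unitarymx.
have : char_poly H = char_poly (diag_mx a).
  by rewrite HE char_poly_conjugate // unitarymx_unit.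
rewrite -map_char_poly chiE char_poly_trig ?diag_mx_is_trig // rmorph_prod.
pose sq := [seq (s ^+ 2)%:C%C | s <- singular_values M].
have -> : \prod_(s <- singular_values M)
    map_poly (real_complex K) ('X - (s ^+ 2)%:P) = \prod_(z <- sq) ('X - z%:P).
  by rewrite big_map; apply: eq_bigr => s _; rewrite rmorphB /= map_polyX map_polyC.
have szq : size sq == n by rewrite size_map sz.
have -> : \prod_(i < n) ('X - (diag_mx a i i)%:P) =
    \prod_(z <- [tuple a 0 i | i < n]) ('X - z%:P).
  rewrite big_map big_enum; apply: eq_bigr => i _.
  by rewrite mxE eqxx mulr1n.
move=> /prod_XsubC_eq; rewrite -[sq]/(tval (Tuple szq)).
move=> /tuple_permP[s sE].
have aE (j : 'I_n) : (nth 0 (singular_values M) j ^+ 2)%:C%C = a 0 (s j).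
  transitivity (tnth (Tuple szq) j).
    by rewrite (tnth_nth 0) /= (nth_map 0) // sz.
  by rewrite (tnth_nth 0) sE -tnth_nth !tnth_mktuple.
(* By [aE], row [j] of this matrix is a left eigenvector of [H] for the square of the [j]-th
   singular value. *)
exists (row_perm s Q).
  apply/unitarymxP; rewrite row_permE trmx_mul map_mxM mulmxA mulmxtVK //.
  rewrite -row_permE tr_perm_mx map_perm_mx.
  by rewrite row_permE -perm_mxM mulgV perm_mx1.
move=> v; rewrite sqnorm_mulmx adjoint_complexify trmxK -map_mxM -/H HE.
rewrite invmx_unitary //; pose w := v *m Q^t*.
have -> : v *m (Q^t* *m diag_mx a *m Q) *m v^t* = w *m diag_mx a *m w^t*.
  by rewrite trmx_mul map_mxM /= trmxCK !mulmxA.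
rewrite mul_mx_diag mxE (reindex_inj (@perm_inj _ s)).
apply: eq_bigr => j _; rewrite aE.
have -> : (v *m (row_perm s Q)^t*) 0 j = w 0 (s j).
  by rewrite !mxE; apply: eq_bigr => k _; rewrite !mxE.
by rewrite !mxE normCK mulrAC mulrC.
Qed.

(** * Comparison of singular values and norms through quadratic forms *)

Lemma sqnorm_gt0 (C : numClosedFieldType) (n : nat) (v : 'rV[C]_n) :
  v != 0 -> 0 < sqnorm v.
Proof. exact: dotmx_is_dotmx. Qed.

(** In eigenvector coordinates every weight is at most the square of the largest singular value, and
    the unitary change of coordinates preserves the norm. *)
Lemma spectral_norm_bound (K : realType) (m n : nat) (M : 'M[K]_(m, n))
    (v : 'rV[K[i]]_n) :
  sqnorm (v *m complexify M^T) <= (spectral_norm M ^+ 2)%:C%C * sqnorm v.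
Proof.
have [P Pu ->] := gram_diagonalization M.
rewrite -(@sqnorm_unitary _ _ _ v (P^t*)) ?trmxC_unitary // sqnormE mulr_sumr.
apply: ler_sum => j _; apply: ler_wpM2r; first exact: exprn_ge0.
rewrite lecR /spectral_norm ler_sqr ?nnegrE ?nth_singular_value_ge0 //.
by apply: singular_values_sorted; rewrite ltn_ord.
Qed.

Lemma singular_values_le (K : realType) (m1 m2 n : nat) (N : 'M[K]_(m1, n))
    (M : 'M[K]_(m2, n)) (k : K) (j : nat) :
  0 <= k ->
  (forall v : 'rV_n,
    sqnorm (v *m complexify N^T) <=
      (k ^+ 2)%:C%C * sqnorm (v *m complexify M^T)) ->
  nth 0 (singular_values N) j <= k * nth 0 (singular_values M) j.
Proof.
move=> k_ge0 NM.
have [_ szN] := singular_values_char_poly N.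
have [_ szM] := singular_values_char_poly M.
(* Both lists have length [n]; past their end both sides take the default value 0. *)
have [nj|jn] := leqP n j; first by rewrite !nth_default ?szN ?szM // mulr0.
have [P Pu NE] := gram_diagonalization N.
have [Q Qu ME] := gram_diagonalization M.
(* The span of the first j + 1 eigenvectors of N^T N contains a nonzero v
   orthogonal to the first j eigenvectors of M^T M. *)
pose f := widen_ord jn; pose g := widen_ord (ltnW jn).
pose T := rowsub f P *m (rowsub g Q)^t*.
(* [T] has [j + 1] rows but only [j] columns, so its left kernel is nonzero. *)
have /rowV0Pn[u uT u_neq0] : kermx T != 0.
  by rewrite -mxrank_eq0 mxrank_ker -lt0n subn_gt0 ltnS rank_leq_col.
have {}uT : u *m T = 0 by apply/sub_kermxP.
pose v := u *m rowsub f P.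
have Pfu : rowsub f P \is unitarymx.
  apply/row_unitarymxP => a b; rewrite !row_rowsub.
  by have /row_unitarymxP -> := Pu.
have v_gt0 : 0 < sqnorm v by rewrite sqnorm_unitary // sqnorm_gt0.
have vP0 (a : 'I_n) : (j < a)%N -> (v *m P^t*) 0 a = 0.
  move=> ja; rewrite /v -mulmxA mul_rowsub_mx (unitarymxP Pu) mxE big1 // => b _.
  by rewrite !mxE -val_eqE /= ltn_eqF ?mulr0 // (leq_trans _ ja) // ltn_ord.
have vQ0 (a : 'I_n) : (a < j)%N -> (v *m Q^t*) 0 a = 0.
  move=> aj; have /matrixP/(_ 0 (Ordinal aj)) := uT.
  rewrite mulmxA -/v [RHS]mxE => <-; rewrite !mxE.
  apply: eq_bigr => b _; rewrite !mxE; congr (_ * (Q _ _)^*%C).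
  exact: val_inj.
(* By [vP0] only the coordinates [a <= j] survive, whose weights are at least the [j]-th. *)
have lower : (nth 0 (singular_values N) j ^+ 2)%:C%C * sqnorm v <=
    sqnorm (v *m complexify N^T).
  rewrite NE -(@sqnorm_unitary _ _ _ v (P^t*)) ?trmxC_unitary // sqnormE mulr_sumr.
  apply: ler_sum => a _; have [aj|ja] := leqP a j; last first.
    by rewrite vP0 // normr0 expr0n !mulr0.
  apply: ler_wpM2r; first exact: exprn_ge0.
  rewrite lecR ler_sqr ?nnegrE ?nth_singular_value_ge0 //.
  by apply: singular_values_sorted; rewrite aj.
(* By [vQ0] only the coordinates [a >= j] survive, whose weights are at most the [j]-th. *)
have upper : sqnorm (v *m complexify M^T) <=
    (nth 0 (singular_values M) j ^+ 2)%:C%C * sqnorm v.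
  rewrite ME -(@sqnorm_unitary _ _ _ v (Q^t*)) ?trmxC_unitary // sqnormE mulr_sumr.
  apply: ler_sum => a _; have [ja|aj] := leqP j a; last first.
    by rewrite vQ0 // normr0 expr0n !mulr0.
  apply: ler_wpM2r; first exact: exprn_ge0.
  rewrite lecR ler_sqr ?nnegrE ?nth_singular_value_ge0 //.
  by apply: singular_values_sorted; rewrite ja /=.
rewrite -ler_sqr ?nnegrE ?mulr_ge0 ?nth_singular_value_ge0 // -lecR.
rewrite -(ler_pM2r v_gt0) (le_trans lower) // (le_trans (NM v)) //.
rewrite exprMn (rmorphM _ (k ^+ 2)) -mulrA.
by apply: ler_wpM2l; rewrite ?ler0c ?sqr_ge0.
Qed.

(** Equal numbers of columns give lists of equal length, which are compared term by term; for [+oo]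
    the first terms suffice. *)
Lemma schatten_norm_le (K : realType) (p : \bar K) (m1 m2 n : nat)
    (N : 'M[K]_(m1, n)) (M : 'M[K]_(m2, n)) (k : K) :
  (1 <= p)%E -> 0 <= k ->
  (forall v : 'rV_n,
    sqnorm (v *m complexify N^T) <=
      (k ^+ 2)%:C%C * sqnorm (v *m complexify M^T)) ->
  schatten_norm p N <= k * schatten_norm p M.
Proof.
move=> p_ge1 k_ge0 /(singular_values_le _ k_ge0) NM.
case: p p_ge1 => [q|_|] //; last exact: NM.
rewrite lee_fin => q_ge1; have q_gt0 : 0 < q by exact: lt_le_trans q_ge1.
have [_ szN] := singular_values_char_poly N.
have [_ szM] := singular_values_char_poly M.
have qV_ge0 : 0 <= q^-1 by rewrite invr_ge0 ltW.
have sM_ge0 : 0 <= \sum_(s <- singular_values M) s `^ q.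
  by apply: sumr_ge0 => s _; exact: powR_ge0.
(* In this form [k] can enter the root, and then the sum, as a factor of each singular value. *)
have -> : k = (k `^ q) `^ q^-1 by rewrite -powRrM divff ?gt_eqF // powRr1.
rewrite /= -powRM ?powR_ge0 //.
apply: ge0_ler_powR => //; rewrite ?nnegrE ?mulr_ge0 ?powR_ge0 //.
  by apply: sumr_ge0 => s _; exact: powR_ge0.
rewrite (big_nth 0) [in leRHS](big_nth 0) szN szM mulr_sumr.
apply: ler_sum => j _; rewrite -powRM ?nth_singular_value_ge0 //.
apply: ge0_ler_powR => //; first exact: ltW.
  by rewrite nnegrE nth_singular_value_ge0.
by rewrite nnegrE mulr_ge0 ?nth_singular_value_ge0.
Qed.

Lemma complexify_unitary (K : realType) (m n : nat) (Q : 'M[K]_(m, n)) :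
  orthonormal_columns Q -> complexify Q^T \is unitarymx.
Proof.
move=> QQ; apply/unitarymxP.
by rewrite adjoint_complexify trmxK -map_mxM QQ map_mx1.
Qed.

(** * Moore-Penrose inverses of matrices of full column rank *)

Lemma mpinvK (K : realType) (m n : nat) (M : 'M[K]_(m, n)) :
  \rank M = n -> mpinv M *m M = 1%:M.
Proof.
move=> /eqP /row_fullP[L LM]; have [MGM _ _ _] := mpinvP M.
by rewrite -[LHS]mul1mx -LM -mulmxA (mulmxA M) MGM.
Qed.

(** This reversal of factors can fail for general products. Here [mpinv M] is a left inverse, so one
    Penrose projector becomes 1 and the other stays [M *m mpinv M]. *)
Lemma mpinv_mul_unit (K : realType) (m n : nat) (M : 'M[K]_(m, n))
    (R : 'M[K]_n) :
  \rank M = n -> R \in unitmx -> mpinv (M *m R) = invmx R *m mpinv M.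
Proof.
move=> rkM Ru; apply: mpinv_unique (mpinvP _) _.
have [_ _ MGT _] := mpinvP M; have GM := mpinvK rkM.
have MRG : M *m R *m (invmx R *m mpinv M) = M *m mpinv M.
  by rewrite -mulmxA mulKVmx.
have GMR : invmx R *m mpinv M *m (M *m R) = 1%:M.
  by rewrite -mulmxA (mulmxA (mpinv M)) GM mul1mx mulVmx.
by split; rewrite ?GMR ?MRG ?trmx1 ?mul1mx // mulmxA -(mulmxA M) GM mulmx1.
Qed.

Lemma mpinv_orthonormal (K : realType) (m n : nat) (Q : 'M[K]_(m, n)) :
  orthonormal_columns Q -> mpinv Q = Q^T.
Proof.
move=> QQ; apply: mpinv_unique (mpinvP _) _.
have QTQ : Q^T *m Q = 1%:M := QQ.
split; rewrite ?QTQ ?trmx1 ?mul1mx //; first by rewrite -mulmxA QTQ mulmx1.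
by rewrite trmx_mul trmxK.
Qed.

Theorem proposition4 (K : realType) (m n c d : nat)
    (m_gt0 : (0 < m)%N) (n_gt0 : (0 < n)%N) (c_gt0 : (0 < c)%N)
    (d_gt0 : (0 < d)%N) (le_nc : (n <= c)%N) (le_cm : (c <= m)%N)
    (A : 'M[K]_(m, n)) (rankA : \rank A = n)
    (B : 'M[K]_(m, d)) (S : 'M[K]_(c, m))
    (Q : 'M[K]_(m, n)) (R : 'M[K]_n) (A_QR : A = Q *m R)
    (Q_orthonormal : orthonormal_columns Q)
    (R_upper : upper_triangular R) (R_nonsingular : R \in unitmx)
    (Qperp : 'M[K]_(m, m - n))
    (QQperp_orthogonal : orthogonal_matrix (row_mx Q Qperp))
    (Xhat : 'M[K]_(n, d)) (Xhat_def : Xhat = mpinv A *m B)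
    (Rhat : 'M[K]_(m, d)) (Rhat_def : Rhat = B - A *m Xhat)
    (Xtilde : 'M[K]_(n, d)) (Xtilde_def : Xtilde = mpinv (S *m A) *m (S *m B))
    (rankSA : \rank (S *m A) = \rank A)
    (p : \bar K) (p_ge1 : (1 <= p)%E) :
  schatten_norm p (Xtilde - Xhat) <=
    spectral_norm (mpinv A) * spectral_norm (mpinv (S *m Q) *m (S *m Qperp))
      * schatten_norm p Rhat.
Proof.
have [UTU UUT] := QQperp_orthogonal.
have Qp_orthonormal : orthonormal_columns Qperp.
  move: UTU; rewrite tr_row_mx mul_col_row => /(congr1 drsubmx).
  by rewrite scalar_mx_block !block_mxKdr.
have projE : Qperp *m Qperp^T = 1%:M - Q *m Q^T.
  by rewrite -UUT tr_row_mx mul_row_col addrC addKr.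
have R_free : row_free R by rewrite row_free_unit.
have rankQ : \rank Q = n by rewrite -(mxrankMfree Q R_free) -A_QR.
have rankSQ : \rank (S *m Q) = n.
  by rewrite -(mxrankMfree _ R_free) -mulmxA -A_QR rankSA.
have GA : mpinv A = invmx R *m Q^T.
  by rewrite A_QR mpinv_mul_unit // mpinv_orthonormal.
have GSA : mpinv (S *m A) = invmx R *m mpinv (S *m Q).
  by rewrite A_QR mulmxA mpinv_mul_unit.
set G := mpinv A; set W := mpinv (S *m Q) *m (S *m Qperp).
pose E := Qperp^T *m B.
(* [A *m Xhat] is the projection [Q *m Q^T *m B], so the residual is the complementary projection of
   [B]. *)
have RhatE : Rhat = Qperp *m E.
  rewrite mulmxA projE mulmxBl mul1mx Rhat_def Xhat_def GA A_QR.
  by rewrite mulmxA -(mulmxA Q) mulKVmx // !mulmxA.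
have diffE : Xtilde - Xhat = G *m Q *m W *m E.
  (* Writing [invmx R] as [G *m Q] makes the norm of [mpinv A] appear in the bound. *)
  have -> : G *m Q = invmx R.
    by rewrite /G GA -mulmxA Q_orthonormal mulmx1.
  (* The left inverse [mpinv (S *m A)] turns [S *m A *m Xhat] back into [Xhat]. *)
  have -> : Xtilde - Xhat = mpinv (S *m A) *m (S *m Rhat).
    rewrite Rhat_def !mulmxBr (mulmxA S A) (mulmxA _ (S *m A)).
    by rewrite mpinvK ?rankSA // mul1mx Xtilde_def.
  by rewrite RhatE GSA /W !mulmxA.
apply: schatten_norm_le => //; first by rewrite mulr_ge0 ?nth_singular_value_ge0.
move=> v.
have -> : sqnorm (v *m complexify Rhat^T) = sqnorm (v *m complexify E^T).
  by rewrite RhatE trmx_mul map_mxM mulmxA sqnorm_unitary ?complexify_unitary.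
(* The factors are peeled off from the last applied: [G] costs its squared norm, the isometry [Q]
   nothing, and [W] its squared norm. *)
clearbody W; rewrite diffE !trmx_mul !map_mxM !mulmxA.
apply: le_trans (spectral_norm_bound _ _) _.
rewrite sqnorm_unitary ?complexify_unitary //.
rewrite exprMn (rmorphM _ (spectral_norm G ^+ 2)) -mulrA.
apply: ler_wpM2l; first by rewrite ler0c sqr_ge0.
exact: spectral_norm_bound.
Qed.
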